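(* Let $\mathcal{A}=\left(\frac{-a,-b}{\mathbb{Q}}\right)$ be a rational quaternion division algebra with $a,b>0$, and let $H$ be an order in $\mathcal{A}$. Suppose $H$ is a left principal ideal domain. Let $\theta\in H$ be primitive and let $m\in\mathbb{N}$ with $m\mid \mathrm{N}(\theta)$. Then there exists $\gamma\in H$ with $\mathrm{N}(\gamma)=m$ which is a right divisor of $\theta$ (i.e. $\theta=f\gamma$ for some $f\in H$), and any right divisor $\delta\in H$ of $\theta$ with $\mathrm{N}(\delta)=m$ is a left associate of $\gamma$ (i.e. $\gamma=u\delta$ for some unit $u$ of $H$). Symmetrically, if $H$ is a right principal ideal domain, then $\theta$ has a left divisor of norm $m$, unique up to right associates.
   Context: $\mathcal{A}$ has $\mathbb{Q}$-basis $1,i,j,k$ with $i^2=-a$, $j^2=-b$, $k=ij=-ji$; the conjugate of $\alpha=x_0+x_1i+x_2j+x_3k$ is $\overline{\alpha}=x_0-x_1i-x_2j-x_3k$ and the norm is $\mathrm{N}(\alpha)=\alpha\overline{\alpha}=x_0^2+ax_1^2+bx_2^2+abx_3^2$. An order $H$ is a subring of $\mathcal{A}$ containing $1$ which is a finitely generated $\mathbb{Z}$-module with $H\otimes_{\mathbb{Z}}\mathbb{Q}=\mathcal{A}$. $H$ is a left (right) principal ideal domain if every left (right) ideal of $H$ is of the form $H\gamma$ ($\gamma H$). An element $\theta\in H$ is primitive if there is no integer $n\neq\pm1$ with $\theta/n\in H$. *)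

(* Defs.v *)
From HB Require Import structures.
From mathcomp Require Import all_boot all_order all_algebra.
From mathcomp Require Import ring.

Set Implicit Arguments.
Unset Strict Implicit.
Unset Printing Implicit Defensive.

Import Order.TTheory GRing.Theory Num.Theory.
Local Open Scope ring_scope.

(* Quat x0 x1 x2 x3 stands for x0 + x1 i + x2 j + x3 k in (-a, -b / Q), where
   i^2 = -a, j^2 = -b and k = i j = - j i.  The parameters a and b are phantom
   in the carrier and only enter through the product. *)
Record quat (a b : rat) : Type :=
  Quat { q0 : rat; q1 : rat; q2 : rat; q3 : rat }.

Arguments Quat {a b}.

Section QuaternionAlgebra.

Variables a b : rat.
Local Notation A := (quat a b).
Implicit Types x y z : A.

Definition quat_tuple x := (q0 x, q1 x, q2 x, q3 x).
Definition tuple_quat (t : rat * rat * rat * rat) : A :=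
  let: (x0, x1, x2, x3) := t in Quat x0 x1 x2 x3.

Fact quat_tupleK : cancel quat_tuple tuple_quat.
Proof. by case. Qed.

HB.instance Definition _ := Equality.copy A (can_type quat_tupleK).
HB.instance Definition _ := Choice.copy A (can_type quat_tupleK).

Definition quat_add x y : A :=
  Quat (q0 x + q0 y) (q1 x + q1 y) (q2 x + q2 y) (q3 x + q3 y).
Definition quat_opp x : A := Quat (- q0 x) (- q1 x) (- q2 x) (- q3 x).

Fact quat_addA : associative quat_add.
Proof. by move=> x y z; rewrite /quat_add /=; congr Quat; ring. Qed.

Fact quat_addC : commutative quat_add.
Proof. by move=> x y; rewrite /quat_add /=; congr Quat; ring. Qed.

Fact quat_add0l : left_id (Quat 0 0 0 0) quat_add.
Proof. by case=> *; rewrite /quat_add /=; congr Quat; ring. Qed.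

Fact quat_addNl : left_inverse (Quat 0 0 0 0) quat_opp quat_add.
Proof. by case=> *; rewrite /quat_add /=; congr Quat; ring. Qed.

HB.instance Definition _ := GRing.isZmodule.Build A
  quat_addA quat_addC quat_add0l quat_addNl.

Definition quat_mul x y : A :=
  Quat (q0 x * q0 y - a * q1 x * q1 y - b * q2 x * q2 y - a * b * q3 x * q3 y)
       (q0 x * q1 y + q1 x * q0 y + b * q2 x * q3 y - b * q3 x * q2 y)
       (q0 x * q2 y + q2 x * q0 y - a * q1 x * q3 y + a * q3 x * q1 y)
       (q0 x * q3 y + q3 x * q0 y + q1 x * q2 y - q2 x * q1 y).

Fact quat_mulA : associative quat_mul.
Proof. by move=> x y z; rewrite /quat_mul /=; congr Quat; ring. Qed.

Fact quat_mul1l : left_id (Quat 1 0 0 0) quat_mul.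
Proof. by case=> *; rewrite /quat_mul /=; congr Quat; ring. Qed.

Fact quat_mul1r : right_id (Quat 1 0 0 0) quat_mul.
Proof. by case=> *; rewrite /quat_mul /=; congr Quat; ring. Qed.

Fact quat_mulDl : left_distributive quat_mul +%R.
Proof. by move=> x y z; rewrite /quat_mul /=; congr Quat; rewrite /=; ring. Qed.

Fact quat_mulDr : right_distributive quat_mul +%R.
Proof. by move=> x y z; rewrite /quat_mul /=; congr Quat; rewrite /=; ring. Qed.

Fact quat_1_neq0 : Quat 1 0 0 0 != 0 :> A.
Proof. by []. Qed.

HB.instance Definition _ := GRing.Zmodule_isNzRing.Build A
  quat_mulA quat_mul1l quat_mul1r quat_mulDl quat_mulDr quat_1_neq0.

Definition quat_scale (c : rat) x : A :=
  Quat (c * q0 x) (c * q1 x) (c * q2 x) (c * q3 x).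

Fact quat_scaleA c d x : quat_scale c (quat_scale d x) = quat_scale (c * d) x.
Proof. by rewrite /quat_scale /=; congr Quat; ring. Qed.

Fact quat_scale1 : left_id 1 quat_scale.
Proof. by case=> *; rewrite /quat_scale /=; congr Quat; ring. Qed.

Fact quat_scaleDr : right_distributive quat_scale +%R.
Proof. by move=> c x y; rewrite /quat_scale /=; congr Quat; rewrite /=; ring. Qed.

Fact quat_scaleDl x : {morph quat_scale^~ x : c d / c + d}.
Proof. by move=> c d; rewrite /quat_scale /=; congr Quat; rewrite /=; ring. Qed.

HB.instance Definition _ := GRing.Zmodule_isLmodule.Build rat A
  quat_scaleA quat_scale1 quat_scaleDr quat_scaleDl.

Fact quat_scaleAl (c : rat) x y : c *: (x * y) = (c *: x) * y.
Proof. by congr Quat; rewrite /=; ring. Qed.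

HB.instance Definition _ := GRing.Lmodule_isLalgebra.Build rat A quat_scaleAl.

Fact quat_scaleAr (c : rat) x y : c *: (x * y) = x * (c *: y).
Proof. by congr Quat; rewrite /=; ring. Qed.

HB.instance Definition _ := GRing.Lalgebra_isAlgebra.Build rat A quat_scaleAr.

Definition quat_conj x : A := Quat (q0 x) (- q1 x) (- q2 x) (- q3 x).

Definition quat_norm x : rat :=
  q0 x ^+ 2 + a * q1 x ^+ 2 + b * q2 x ^+ 2 + a * b * q3 x ^+ 2.

Lemma quat_mul_conj x : x * quat_conj x = (quat_norm x)%:A.
Proof. by rewrite /quat_norm; congr Quat; rewrite /=; ring. Qed.

Definition qi : A := Quat 0 1 0 0.
Definition qj : A := Quat 0 0 1 0.
Definition qk : A := Quat 0 0 0 1.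

Lemma quatE x : x = (q0 x)%:A + q1 x *: qi + q2 x *: qj + q3 x *: qk.
Proof. by case: x => *; congr Quat; rewrite /=; ring. Qed.

Lemma quat_mul_ii : qi * qi = (- a)%:A.
Proof. by congr Quat; rewrite /=; ring. Qed.

Lemma quat_mul_jj : qj * qj = (- b)%:A.
Proof. by congr Quat; rewrite /=; ring. Qed.

Lemma quat_mul_ij : qi * qj = qk.
Proof. by congr Quat; rewrite /=; ring. Qed.

Lemma quat_mul_ji : qj * qi = - qk.
Proof. by congr Quat; rewrite /=; ring. Qed.

End QuaternionAlgebra.

Definition division_ring (R : nzRingType) : Prop :=
  forall x : R, x != 0 -> exists y : R, x * y = 1 /\ y * x = 1.

(* The canonical map H (x)_Z Q -> A sends h (x) c to c *: h.  It is always
   injective, as H is a subgroup of the Q-vector space A, so H (x)_Z Q = A means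
   that it is surjective: this is the third clause. *)
Definition is_order (A : algType rat) (H : {pred A}) : Prop :=
  [/\ subring_closed H,
      exists (n : nat) (s : n.-tuple A), forall x : A, x \in H <-> inIntSpan s x
    & forall x : A, exists (n : nat) (c : 'I_n -> rat) (h : 'I_n -> A),
        (forall i, h i \in H) /\ x = \sum_i c i *: h i].

Section OneSidedIdeals.

Variables (R : nzRingType) (H : {pred R}).

Definition left_ideal (I : {pred R}) : Prop :=
  [/\ {subset I <= H}, zmod_closed I & {in H & I, forall h x, h * x \in I}].

Definition right_ideal (I : {pred R}) : Prop :=
  [/\ {subset I <= H}, zmod_closed I & {in H & I, forall h x, x * h \in I}].

Definition left_pid : Prop :=
  forall I : {pred R}, left_ideal I ->
  exists2 g, g \in H & forall x, x \in I <-> exists2 h, h \in H & x = h * g.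

Definition right_pid : Prop :=
  forall I : {pred R}, right_ideal I ->
  exists2 g, g \in H & forall x, x \in I <-> exists2 h, h \in H & x = g * h.

Definition right_divisor (d t : R) : Prop := exists2 f, f \in H & t = f * d.

Definition left_divisor (d t : R) : Prop := exists2 f, f \in H & t = d * f.

Definition unit_of (u : R) : Prop :=
  u \in H /\ exists2 v, v \in H & u * v = 1 /\ v * u = 1.

Definition left_associate (g d : R) : Prop := exists2 u, unit_of u & g = u * d.

Definition right_associate (g d : R) : Prop := exists2 u, unit_of u & g = d * u.

End OneSidedIdeals.

(* t / n only makes sense for n != 0; without this restriction n = 0 would rule
   out every t, as 0^-1 = 0 in rat.  Note that t = 0 is not primitive. *)
Definition primitive (A : algType rat) (H : {pred A}) (t : A) : Prop :=
  t \in H /\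
  forall n : int, n != 0 -> (n%:~R : rat)^-1 *: t \in H -> n = 1 \/ n = -1.

(* Main.v *)
Require Import Defs.
From HB Require Import structures.
From mathcomp Require Import all_boot all_order all_algebra.
From mathcomp Require Import ring lra.
From mathcomp Require Import boolp.

Set Implicit Arguments.
Unset Strict Implicit.
Unset Printing Implicit Defensive.

Import Order.TTheory GRing.Theory Num.Theory.
Local Open Scope ring_scope.

(** Put H theta + H m = H gamma and N(gamma) = m c; then c is a positive integer
    dividing m.  As m c divides the norm of every h theta + m, c divides
    tr(h theta) for all h in H, and c^2 divides N(theta).  Hence t = theta / c
    satisfies t h t = tr(h t) t - N(t) conj(h), with tr(h t) and N(t) integers,
    so H + H t H is a ring, in fact an order.

    An order O containing a left principal ideal order H equals H: for some
    integer n > 0 the left ideal n O is H g, and then g O is contained in H g.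
    Conjugation by g thus maps O into H; it preserves the norm, and there are
    only finitely many elements of H of given norm, so each x in O is returned
    to itself by some power of this conjugation, whence x lies in H.

    So theta / c is in H, and c = 1 because theta is primitive.  The statement
    on left divisors follows by applying the conjugation of the algebra. *)

(** * Conjugation, trace and norm on the quaternion algebra *)

Section QuaternionIdentities.

Variables a b : rat.
Implicit Types x y : quat a b.

Definition quat_trace x : rat := q0 x *+ 2.

Lemma quat_conjK : involutive (@quat_conj a b).
Proof. by case=> *; congr Quat; rewrite /=; ring. Qed.

Lemma quat_conjM x y : quat_conj (x * y) = quat_conj y * quat_conj x.
Proof. by congr Quat; rewrite /=; ring. Qed.

Lemma quat_conjB x y : quat_conj (x - y) = quat_conj x - quat_conj y.
Proof. by congr Quat; rewrite /=; ring. Qed.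

Lemma quat_conjZ c x : quat_conj (c *: x) = c *: quat_conj x.
Proof. by congr Quat; rewrite /=; ring. Qed.

Lemma quat_conj1 : quat_conj 1 = 1 :> quat a b.
Proof. by congr Quat; rewrite /=; ring. Qed.

Lemma quat_conj_trace x : quat_conj x = (quat_trace x)%:A - x.
Proof. by rewrite /quat_trace; congr Quat; rewrite /=; ring. Qed.

Lemma quat_conj_mul x : quat_conj x * x = (quat_norm x)%:A.
Proof. by rewrite /quat_norm; congr Quat; rewrite /=; ring. Qed.

Lemma quat_normM x y : quat_norm (x * y) = quat_norm x * quat_norm y.
Proof. by rewrite /quat_norm /=; ring. Qed.

Lemma quat_normZ c x : quat_norm (c *: x) = c ^+ 2 * quat_norm x.
Proof. by rewrite /quat_norm /=; ring. Qed.

Lemma quat_norm_conj x : quat_norm (quat_conj x) = quat_norm x.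
Proof. by rewrite /quat_norm /=; ring. Qed.

Lemma quat_norm1 : quat_norm (1 : quat a b) = 1.
Proof. by rewrite /quat_norm /=; ring. Qed.

Lemma quat_normX x n : quat_norm (x ^+ n) = quat_norm x ^+ n.
Proof.
by elim: n => [|n IHn]; rewrite ?quat_norm1 // !exprS quat_normM IHn.
Qed.

Lemma quat_normDA x c :
  quat_norm (x + c%:A) = quat_norm x + c * quat_trace x + c ^+ 2.
Proof. by rewrite /quat_norm /quat_trace /=; ring. Qed.

Lemma quat_normDZ x y c :
  quat_norm (x + c *: y) =
  quat_norm x + c * quat_trace (x * quat_conj y) + c ^+ 2 * quat_norm y.
Proof. by rewrite /quat_norm /quat_trace /=; ring. Qed.

Lemma quat_traceZ c x : quat_trace (c *: x) = c * quat_trace x.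
Proof. by rewrite /quat_trace /=; ring. Qed.

(** Write [y * x] as its trace minus its conjugate, and use that [x] times its conjugate is the
    norm. *)
Lemma quat_sandwich x y :
  x * y * x = quat_trace (y * x) *: x - quat_norm x *: quat_conj y.
Proof. by rewrite /quat_trace /quat_norm; congr Quat; rewrite /=; ring. Qed.

Lemma quat_norm_ge_coord x : 0 < a -> 0 < b ->
  [/\ q0 x ^+ 2 <= quat_norm x, a * q1 x ^+ 2 <= quat_norm x,
      b * q2 x ^+ 2 <= quat_norm x & a * b * q3 x ^+ 2 <= quat_norm x].
Proof.
move=> a0 b0; have ab0 : 0 < a * b by rewrite mulr_gt0.
have sq c (y : rat) : 0 < c -> 0 <= c * y ^+ 2.
  by move=> c0; rewrite mulr_ge0 ?sqr_ge0 ?ltW.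
have := sqr_ge0 (q0 x); have := sq _ (q1 x) a0.
have := sq _ (q2 x) b0; have := sq _ (q3 x) ab0.
by rewrite /quat_norm => *; split; lra.
Qed.

Lemma quat_norm_ge0 x : 0 < a -> 0 < b -> 0 <= quat_norm x.
Proof.
move=> a0 b0; have [h _ _ _] := quat_norm_ge_coord x a0 b0.
by rewrite (le_trans _ h) ?sqr_ge0.
Qed.

Lemma quat_norm_eq0 x : 0 < a -> 0 < b -> quat_norm x = 0 -> x = 0.
Proof.
move=> a0 b0 Nx; have [] := quat_norm_ge_coord x a0 b0; rewrite Nx.
rewrite (pmulr_rle0 _ a0) (pmulr_rle0 _ b0) (pmulr_rle0 _ (mulr_gt0 a0 b0)).
move=> h0 h1 h2 h3.
have sq0 (y : rat) : y ^+ 2 <= 0 -> y = 0.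
  by move=> h; apply/eqP; rewrite -sqrf_eq0 eq_le h sqr_ge0.
by case: x {Nx} h0 h1 h2 h3 => x0 x1 x2 x3 /= /sq0-> /sq0-> /sq0-> /sq0->.
Qed.

End QuaternionIdentities.

(** * Integrality from bounded denominators, and the pigeonhole principle *)

Lemma rat_int_bounded_powers (r : rat) (e : int) : e != 0 ->
  (forall k, e%:~R * r ^+ k \is a Num.int) -> r \is a Num.int.
Proof.
move=> e0 er; rewrite Qint_def.
have dvd k : (`|denq r| ^ k %| `|e|)%N.
  have /intrP[z ez] := er k.
  have E : e * numq r ^+ k = z * denq r ^+ k.
    apply/eqP; rewrite -(eqr_int rat) !rmorphM !rmorphXn /= -ez.
    by rewrite -mulrA -exprMn numqE.
  have /= := congr1 absz E; rewrite !abszM !abszX => {}E.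
  (* Powers of the numerator are coprime to those of the denominator, which must therefore divide
     [e]. *)
  have cop : coprime (`|denq r| ^ k) (`|numq r| ^ k).
    by apply/coprimeXl/coprimeXr; rewrite coprime_sym coprime_num_den.
  by rewrite -(Gauss_dvdl _ cop) E dvdn_mull.
have d0 := denq_gt0 r.
have dE : (`|denq r|%N : int) = denq r by rewrite gtz0_abs.
(* A denominator above 1, raised to the power [|e|], would exceed its multiple [e]. *)
rewrite -dE eqz_nat eqn_leq absz_gt0 gt_eqF // andbT leqNgt; apply/negP => d1.
by have := ltn_expl `|e| d1; rewrite ltnNge dvdn_leq // ?absz_gt0 //.
Qed.

Lemma seq_repetition (T : eqType) (s : seq T) (f : nat -> T) :
  (forall k, f k \in s) -> exists i j, (i < j)%N /\ f i = f j.
Proof.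
move=> fs; have : ~~ uniq (mkseq f (size s).+1).
  apply/negP => u; have := uniq_leq_size u (s2 := s).
  rewrite size_mkseq ltnn => h; suff : false by [].
  by apply: h => x /mapP[k _ ->].
move=> /(uniqPn (f 0%N))[i [j [ij]]]; rewrite size_mkseq => jn.
by rewrite !nth_mkseq ?(ltn_trans ij) // => e; exists i, j.
Qed.

(** * Common denominators of coordinates *)

Section IntegralCoordinates.

Variables a b : rat.
Implicit Types x y : quat a b.

Definition int_coord x :=
  [&& q0 x \is a Num.int, q1 x \is a Num.int,
      q2 x \is a Num.int & q3 x \is a Num.int].

Lemma int_coord0 : int_coord 0.
Proof. by rewrite /int_coord /= !rpred0. Qed.

Lemma int_coordD x y : int_coord x -> int_coord y -> int_coord (x + y).
Proof. by case/and4P=> ? ? ? ? /and4P[*]; rewrite /int_coord /= !rpredD. Qed.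

Lemma int_coordZ (n : int) x : int_coord x -> int_coord (n%:~R *: x).
Proof. by case/and4P=> *; rewrite /int_coord /= !rpredM ?intr_int. Qed.

Lemma common_denominator (s : seq (quat a b)) :
  exists2 d : int, 0 < d & forall x, x \in s -> int_coord (d%:~R *: x).
Proof.
elim: s => [|x s [d d0 ds]]; first by exists 1.
pose e := denq (q0 x) * denq (q1 x) * denq (q2 x) * denq (q3 x).
have den (r : rat) (m : int) : (denq r %| m)%Z -> m%:~R * r \is a Num.int.
  case/dvdzP=> k ->; rewrite rmorphM /= -mulrA [_ * r]mulrC -numqE.
  by rewrite rpredM ?intr_int.
have ex : int_coord (e%:~R *: x).
  rewrite /int_coord /=; apply/and4P; split; apply: den.
  - by do 3!apply: dvdz_mulr.
  - by do 2!apply: dvdz_mulr; apply: dvdz_mull.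
  - by apply: dvdz_mulr; apply: dvdz_mull.
  - exact: dvdz_mull.
exists (d * e) => [|y]; first by rewrite /e !mulr_gt0 ?denq_gt0.
rewrite inE => /predU1P[->|ys].
  by rewrite rmorphM -scalerA int_coordZ.
by rewrite mulrC rmorphM -scalerA int_coordZ ?ds.
Qed.

End IntegralCoordinates.

(** * Integrality and finiteness in an order *)

Section Order.

Variables a b : rat.
Hypotheses (a_gt0 : 0 < a) (b_gt0 : 0 < b).
Variable H : {pred quat a b}.
Hypothesis orderH : is_order H.
Implicit Types x y : quat a b.

Lemma order1 : 1 \in H. Proof. by case: orderH => -[]. Qed.

Lemma orderB x y : x \in H -> y \in H -> x - y \in H.
Proof. by case: orderH => -[_ + _] _ _; apply. Qed.

Lemma orderM x y : x \in H -> y \in H -> x * y \in H.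
Proof. by case: orderH => -[_ _ +] _ _; apply. Qed.

Lemma order0 : 0 \in H.
Proof. by rewrite -(subrr 1) orderB ?order1. Qed.

Lemma orderN x : x \in H -> - x \in H.
Proof. by rewrite -sub0r; apply: orderB order0. Qed.

Lemma orderD x y : x \in H -> y \in H -> x + y \in H.
Proof. by move=> xH yH; rewrite -[y]opprK orderB ?orderN. Qed.

Lemma orderX x n : x \in H -> x ^+ n \in H.
Proof. by move=> xH; elim: n => [|n IHn]; rewrite ?order1 // exprS orderM. Qed.

Lemma orderZ (c : rat) x : c \is a Num.int -> x \in H -> c *: x \in H.
Proof.
move=> /intrP[n ->] xH.
have natH k : x *+ k \in H.
  by elim: k => [|k IHk]; rewrite ?mulr0n ?order0 // mulrS orderD.
by rewrite scaler_int; case: n => n; [apply: natH | apply/orderN/natH].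
Qed.

Lemma order_denominator :
  exists2 d : int, 0 < d & forall x, x \in H -> int_coord (d%:~R *: x).
Proof.
have [_ [n [s sH]] _] := orderH.
have [d d0 ds] := common_denominator s; exists d => // x /sH[z ->].
rewrite scaler_sumr; elim/big_ind: _ => [||i _].
- exact: int_coord0.
- exact: int_coordD.
- rewrite -scaler_int scalerA mulrC -scalerA int_coordZ // ds // mem_nth //.
  by rewrite size_tuple.
Qed.

(** All powers of [x] lie in [H], so the powers of its norm have bounded denominators. *)
Lemma order_norm_int x : x \in H -> quat_norm x \is a Num.int.
Proof.
have [d d0 dH] := order_denominator => xH.
(* [d ^+ 2] clears the squared coordinates; the other two factors clear the coefficients [a], [b]
   and [a * b]. *)
apply: (@rat_int_bounded_powers _ (d ^+ 2 * denq a * denq b)) => [|k].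
  by rewrite !mulf_neq0 ?expf_neq0 ?denq_neq0 // gt_eqF.
rewrite -quat_normX; have /dH/and4P[] := orderX k xH.
move: (x ^+ k) => [y0 y1 y2 y3] /=; rewrite /quat_norm /= => i0 i1 i2 i3.
have -> : (d ^+ 2 * denq a * denq b)%:~R *
    (y0 ^+ 2 + a * y1 ^+ 2 + b * y2 ^+ 2 + a * b * y3 ^+ 2) =
    (denq a)%:~R * (denq b)%:~R * (d%:~R * y0) ^+ 2 +
    (a * (denq a)%:~R) * (denq b)%:~R * (d%:~R * y1) ^+ 2 +
    (denq a)%:~R * (b * (denq b)%:~R) * (d%:~R * y2) ^+ 2 +
    (a * (denq a)%:~R) * (b * (denq b)%:~R) * (d%:~R * y3) ^+ 2 :> rat.
  by rewrite !rmorphM /=; ring.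
move: (d%:~R * y0) (d%:~R * y1) (d%:~R * y2) (d%:~R * y3) i0 i1 i2 i3.
by move=> *; rewrite -!numqE !(rpredD, rpredM, rpredX) ?intr_int.
Qed.

(** The trace is N(x + 1) - N(x) - 1. *)
Lemma order_trace_int x : x \in H -> quat_trace x \is a Num.int.
Proof.
move=> xH; have := order_norm_int (orderD xH order1).
rewrite -[X in x + X]scale1r quat_normDA mul1r expr1n.
by rewrite rpredDr ?rpred1 // rpredDl ?order_norm_int.
Qed.

Lemma order_conj x : x \in H -> quat_conj x \in H.
Proof.
by move=> xH; rewrite quat_conj_trace orderB // orderZ ?order1 ?order_trace_int.
Qed.

(** The norm is positive definite, so it bounds every coordinate; the coordinates also share the
    denominator [d]. *)
Lemma finite_of_norm (n : rat) :
  exists s : seq (quat a b), forall x, x \in H -> quat_norm x = n -> x \in s.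
Proof.
have [d d0 dH] := order_denominator.
have dQ0 : 0 < d%:~R :> rat by rewrite ltr0z.
pose ab := a * b; have ab0 : 0 < ab by rewrite mulr_gt0.
(* If w t^2 <= n with w among 1, a, b, ab, then (d t)^2 <= d^2 n / w; summing the four inverses
   gives one bound for all coordinates. *)
pose M := Num.trunc (d%:~R ^+ 2 * `|n| * (1 + a^-1 + b^-1 + ab^-1)).
pose r : seq rat := [seq z%:R / d%:~R | z <- iota 0 M.+1] ++
                    [seq - z%:R / d%:~R | z <- iota 0 M.+1].
have rP (w t : rat) : 0 < w -> w^-1 <= 1 + a^-1 + b^-1 + ab^-1 ->
    d%:~R * t \is a Num.int -> w * t ^+ 2 <= n -> t \in r.
  move=> w0 wle /intrP[z dt] tn.
  have tE : t = z%:~R / d%:~R by rewrite -dt mulrAC divff ?mul1r // gt_eqF.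
  have n0 : 0 <= n by rewrite (le_trans _ tn) // mulr_ge0 ?sqr_ge0 ?ltW.
  have zM : (`|z| <= M)%N.
    have K0 : 0 <= 1 + a^-1 + b^-1 + ab^-1 by rewrite !addr_ge0 ?invr_ge0 ?ltW.
    rewrite truncn_ge_nat; last by rewrite !mulr_ge0 // ltW.
    (* An integer is at most its square in absolute value, so no square root is needed. *)
    apply: (@le_trans _ _ ((d%:~R * t) ^+ 2)).
      rewrite dt natr_absz -rmorphXn ler_int -[_ ^+ 2]real_normK ?num_real //.
      by rewrite -abszE; case: `|z|%N => // k; rewrite ler_eXnr.
    rewrite exprMn -mulrA ler_wpM2l ?sqr_ge0 //.
    apply: (@le_trans _ _ (n / w)); first by rewrite ler_pdivlMr // mulrC.
    by rewrite ger0_norm // ler_wpM2l.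
  rewrite tE mem_cat; apply/orP; case: (lerP 0 z) => z0.
    left; apply/mapP; exists `|z|%N; first by rewrite mem_iota add0n ltnS.
    by rewrite natr_absz ger0_norm.
  right; apply/mapP; exists `|z|%N; first by rewrite mem_iota add0n ltnS.
  by rewrite natr_absz ltr0_norm // rmorphN opprK.
move: r rP => r rP.
pose q : seq (rat * rat * rat * rat) :=
  [seq (t, w) | t <- [seq (t, v) | t <- [seq (t, u) | t <- r, u <- r],
     v <- r], w <- r].
exists (map (@tuple_quat a b) q) => x xH Nx.
have /and4P[i0 i1 i2 i3] := dH _ xH.
have [h0 h1 h2 h3] := quat_norm_ge_coord x a_gt0 b_gt0.
rewrite Nx in h0 h1 h2 h3.
have A0 : 0 <= a^-1 by rewrite invr_ge0 ltW.
have B0 : 0 <= b^-1 by rewrite invr_ge0 ltW.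
have AB0 : 0 <= ab^-1 by rewrite invr_ge0 ltW.
rewrite -(quat_tupleK x); apply: map_f.
rewrite /quat_tuple; do 3?apply: allpairs_f.
- by apply: (rP 1); rewrite ?mul1r // invr1; lra.
- by apply: (rP a) => //; lra.
- by apply: (rP b) => //; lra.
- by apply: (rP ab) => //; lra.
Qed.


(** * Maximality of left principal orders *)

Lemma left_pid_maximal (O : {pred quat a b}) (c : rat) :
  left_pid H -> subring_closed O -> {subset H <= O} -> c != 0 ->
  (forall x, x \in O -> c *: x \in H) -> {subset O <= H}.
Proof.
move=> pidH [O1 OB OM] HO c0 cO.
(* This is c O, a left ideal of [H] that is also stable under right multiplication by [O]. *)
pose I : {pred quat a b} := [pred x | c^-1 *: x \in O].
have cI x : (c *: x \in I) = (x \in O) by rewrite inE scalerA mulVf // scale1r.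
have [|g gH gI] := pidH I.
  split=> [x||h x hH].
  - by rewrite inE => /cO; rewrite scalerA mulfV // scale1r.
  - split=> [|x y]; first by rewrite inE scaler0 HO ?order0.
    by rewrite !inE scalerBr; apply: OB.
  - by rewrite !inE scalerAr => xI; apply: OM => //; apply: HO.
(* [c] is a left multiple of [g], and its norm c^2 is nonzero. *)
have Ng0 : quat_norm g != 0.
  have /gI[h _ cE] : c *: 1 \in I by rewrite cI.
  have /eqP := congr1 (@quat_norm a b) cE.
  rewrite quat_normM quat_normZ quat_norm1 mulr1; apply: contraL => /eqP->.
  by rewrite mulr0 expf_eq0.
have gg : g * quat_conj g = (quat_norm g)%:A := quat_mul_conj g.
(* Conjugation by [g], whose inverse is its conjugate divided by its norm. Since g O lies in c O = H
   g, it maps [O] into [H]. *)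
pose phi x := (quat_norm g)^-1 *: (g * x * quat_conj g).
have phiH x : x \in O -> phi x \in H.
  move=> xO; have /gI[h hH gxE] : g * x \in I.
    have gI' : g \in I by apply/gI; exists 1; rewrite ?order1 ?mul1r.
    by rewrite inE scalerAl OM.
  by rewrite /phi gxE -mulrA gg -scalerAr mulr1 scalerA mulVf // scale1r.
have phiN x : quat_norm (phi x) = quat_norm x.
  by rewrite quat_normZ !quat_normM quat_norm_conj; field.
have phi_inj : injective phi.
  apply: (can_inj (g := fun x => (quat_norm g)^-1 *: (quat_conj g * x * g))).
  move=> x; rewrite /phi -scalerAr -scalerAl scalerA !mulrA quat_conj_mul.
  rewrite -!mulrA quat_conj_mul -!scalerAr -scalerAl mulr1 mul1r !scalerA.
  by rewrite -[RHS]scale1r; congr (_ *: _); field.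
move=> x xO.
(* At least one application is needed, as [x] itself is only known to lie in [O]. *)
have iterH k : iter k.+1 phi x \in H.
  by elim: k => [|k IHk]; apply: phiH => //; apply: HO.
have [s sP] := finite_of_norm (quat_norm x).
have [|i [j [ij fij]]] := @seq_repetition _ s (fun k => iter k.+1 phi x).
  move=> k; apply: sP (iterH k) _.
  by elim: k.+1 => //= k' <-.
(* Injectivity cancels the first i + 1 applications; j - i is positive, so the remaining iterate is
   in [H]. *)
have ->: x = iter (j - i) phi x.
  have iter_inj k : injective (iter k phi).
    by elim: k => // k IHk y z /= /phi_inj/IHk.
  by apply: (iter_inj i.+1); rewrite -iterD addSn subnKC // ltnW.
by rewrite -(subnSK ij).
Qed.

(** * The ring H + H t H *)

Inductive adjoin (t : quat a b) : quat a b -> Prop :=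
| adjoin_order h : h \in H -> adjoin t h
| adjoin_gen h k : h \in H -> k \in H -> adjoin t (h * t * k)
| adjoinB x y : adjoin t x -> adjoin t y -> adjoin t (x - y).

Lemma adjoinMl t h x : h \in H -> adjoin t x -> adjoin t (h * x).
Proof.
move=> hH; elim=> [k kH|k l kH lH|y z _ IHy _ IHz].
- by apply: adjoin_order; apply: orderM.
- by rewrite !mulrA; apply: adjoin_gen => //; apply: orderM.
- by rewrite mulrBr; apply: adjoinB.
Qed.

Lemma adjoinMr t h x : h \in H -> adjoin t x -> adjoin t (x * h).
Proof.
move=> hH; elim=> [k kH|k l kH lH|y z _ IHy _ IHz].
- by apply: adjoin_order; apply: orderM.
- by rewrite -[_ * h]mulrA; apply: adjoin_gen => //; apply: orderM.
- by rewrite mulrBl; apply: adjoinB.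
Qed.

(** Only a product of two generators h t k and h' t k' is at stake; [quat_sandwich] rewrites its
    middle t (k h') t as an integer multiple of t minus an element of [H]. *)
Lemma adjoinM t x y : quat_norm t \is a Num.int ->
  (forall h, h \in H -> quat_trace (h * t) \is a Num.int) ->
  adjoin t x -> adjoin t y -> adjoin t (x * y).
Proof.
move=> Nt trt; elim=> [h hH|h k hH kH|z w _ IHz _ IHw] ty.
- exact: adjoinMl.
- elim: ty => [h' h'H|h' k' h'H k'H|z w _ IHz _ IHw].
  + by apply: adjoinMr => //; apply: adjoin_gen.
  + have -> : h * t * k * (h' * t * k') = h * (t * (k * h') * t) * k'.
      by rewrite !mulrA.
    rewrite quat_sandwich mulrBr mulrBl -!scalerAr; apply: adjoinB.
      rewrite scalerAl; apply: adjoin_gen => //.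
      by apply: orderZ => //; apply/trt/orderM.
    apply/adjoin_order; rewrite -scalerAl; apply: orderZ => //.
    by do 2?apply: orderM => //; apply/order_conj/orderM.
  + by rewrite mulrBr; apply: adjoinB.
- by rewrite mulrBl; apply: adjoinB; [apply: IHz | apply: IHw].
Qed.

(** [c] carries H + H t H into [H], since c (h t k) = h (c t) k; maximality then makes this ring
    equal to [H]. *)
Lemma left_pid_mem t (c : rat) :
  left_pid H -> c != 0 -> c \is a Num.int -> c *: t \in H ->
  quat_norm t \is a Num.int ->
  (forall h, h \in H -> quat_trace (h * t) \is a Num.int) -> t \in H.
Proof.
move=> pidH c0 cZ ctH Nt trt.
pose O : {pred quat a b} := [pred x | `[< adjoin t x >]].
have OP x : reflect (adjoin t x) (x \in O) by rewrite inE; apply: asboolP.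
apply: (left_pid_maximal (O := O) pidH _ _ c0).
- split=> [|x y /OP tx /OP ty|x y /OP tx /OP ty]; apply/OP.
  + exact/adjoin_order/order1.
  + exact: adjoinB.
  + exact: adjoinM.
- by move=> x xH; apply/OP/adjoin_order.
- move=> x /OP; elim=> [h hH|h k hH kH|y z _ IHy _ IHz].
  + exact: orderZ.
  + by rewrite scalerAl scalerAr; do 2?apply: orderM.
  + by rewrite scalerBr orderB.
- by apply/OP; have := adjoin_gen t order1 order1; rewrite mul1r mulr1.
Qed.

Lemma primitive_norm_gt0 x : primitive H x -> 0 < quat_norm x.
Proof.
case=> _ prim; rewrite lt_neqAle quat_norm_ge0 // andbT eq_sym.
apply/eqP => /(quat_norm_eq0 a_gt0 b_gt0) x0.
(* Zero is divisible by 2, hence not primitive. *)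
by case: (prim 2); rewrite // x0 scaler0 order0.
Qed.

(** * Existence and uniqueness of the right divisor *)

Lemma left_pid_right_divisor theta (m : nat) :
  left_pid H -> primitive H theta ->
  (exists q : int, quat_norm theta = m%:R * q%:~R) ->
  exists gamma : quat a b,
     [/\ gamma \in H, quat_norm gamma = m%:R, right_divisor H gamma theta
       & forall delta : quat a b, delta \in H -> quat_norm delta = m%:R ->
           right_divisor H delta theta -> left_associate H gamma delta].
Proof.
move=> pidH primH [q NthE]; have [thH prim] := primH.
have Nth_gt0 := primitive_norm_gt0 primH.
set M : rat := m%:R in NthE *.
have M0 : M != 0 by apply: contraTneq Nth_gt0 => M0; rewrite NthE M0 mul0r ltxx.
have MZ : M \is a Num.int by rewrite natr_int.
pose P x := exists h k, [/\ h \in H, k \in H & x = h * theta + M *: k].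
pose I : {pred quat a b} := [pred x | `[< P x >]].
have IP x : reflect (P x) (x \in I) by rewrite inE; apply: asboolP.
have [|gamma gH gI] := pidH I.
  split=> [x /IP[h [k [hH kH ->]]]||h x hH /IP[k [l [kH lH ->]]]].
  - by rewrite orderD ?orderM ?orderZ.
  - split=> [|x y /IP[h [k [hH kH ->]]] /IP[h' [k' [h'H k'H ->]]]]; apply/IP.
      by exists 0, 0; rewrite !order0 mul0r scaler0 addr0.
    exists (h - h'), (k - k'); rewrite !orderB //; split=> //.
    by rewrite mulrBl scalerBr opprD addrACA.
  - apply/IP; exists (h * k), (h * l); rewrite !orderM //; split=> //.
    by rewrite mulrDr mulrA scalerAr.
have /gI[f fH thE] : theta \in I.
  by apply/IP; exists 1, 0; rewrite order0 order1 mul1r scaler0 addr0.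
have /gI[d dH ME] : M%:A \in I.
  by apply/IP; exists 0, 1; rewrite order0 order1 mul0r add0r.
(* Expand the norm of gamma = h theta + m k: each of the three terms is divisible by [m], the first
   because [m] divides N(theta). *)
have [c NgE] : exists c : int, quat_norm gamma = M * c%:~R.
  have /IP[h [k [hH kH gE]]] : gamma \in I.
    by apply/gI; exists 1; rewrite ?order1 ?mul1r.
  have /intrP[c cE] : quat_norm h * q%:~R +
      quat_trace (h * theta * quat_conj k) + M * quat_norm k \is a Num.int.
    apply: rpredD; last by apply: rpredM; rewrite ?order_norm_int.
    apply: rpredD; first by apply: rpredM; rewrite ?intr_int ?order_norm_int.
    by apply: order_trace_int; rewrite !orderM ?order_conj.
  by exists c; rewrite -cE gE quat_normDZ quat_normM NthE; ring.
set C : rat := c%:~R in NgE.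
(* Take norms in m = d gamma and cancel one factor [m]. *)
have MdC : M = quat_norm d * C.
  apply: (mulfI M0); have := congr1 (@quat_norm a b) ME.
  by rewrite quat_normZ quat_norm1 quat_normM NgE mulr1 mulrCA => <-.
have C0 : C != 0 by apply: contraNneq M0 => C0; rewrite MdC C0 mulr0.
have NthfE : quat_norm theta = quat_norm f * (M * C).
  by rewrite thE quat_normM NgE.
have thC : C^-1 *: theta \in H.
  apply: (left_pid_mem pidH C0).
  - exact: intr_int.
  - by rewrite scalerA mulfV // scale1r.
  - have -> : quat_norm (C^-1 *: theta) = quat_norm f * quat_norm d.
      by rewrite quat_normZ NthfE MdC; field.
    by rewrite rpredM ?order_norm_int.
  (* Taking norms in h theta + m = e gamma and dividing by m c expresses tr(h theta) / c through
     integral norms, as m / c = N(d). *)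
  - move=> h hH; have /gI[e eH eE] : h * theta + M%:A \in I.
      by apply/IP; exists h, 1; rewrite order1.
    have -> : quat_trace (h * (C^-1 *: theta)) =
        quat_norm e - quat_norm h * quat_norm f - quat_norm d.
      rewrite -scalerAr quat_traceZ; apply: (mulfI (mulf_neq0 M0 C0)).
      rewrite mulrA mulfK //.
      have := congr1 (@quat_norm a b) eE; rewrite quat_normDA !quat_normM.
      rewrite NthfE NgE => h1.
      have -> : M * quat_trace (h * theta) = quat_norm e * (M * C)
          - quat_norm h * (quat_norm f * (M * C)) - M ^+ 2.
        by rewrite -h1; ring.
      by rewrite MdC; ring.
    by rewrite !rpredB ?rpredM ?order_norm_int.
have M_gt0 : 0 < M by rewrite lt_neqAle eq_sym M0 ler0n.
(* Primitivity leaves c = 1 or -1; the norm of [gamma] is nonnegative, which excludes -1. *)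
have C1 : C = 1.
  have [|//|c1|c1] := prim c; rewrite /C ?c1 //.
    by rewrite -(intr_eq0 rat).
  have := quat_norm_ge0 gamma a_gt0 b_gt0.
  by rewrite NgE /C c1; lra.
have Ng : quat_norm gamma = M by rewrite NgE C1 mulr1.
exists gamma; split=> //; first by exists f.
move=> delta dlH Ndl [f' f'H thE'].
have /IP[h [k [hH kH gE]]] : gamma \in I.
  by apply/gI; exists 1; rewrite ?order1 ?mul1r.
(* Factor [delta] out of h theta + m k, using theta = f' delta and m = N(delta). *)
pose u := h * f' + k * quat_conj delta.
have uH : u \in H by rewrite orderD ?orderM ?order_conj.
have guE : gamma = u * delta.
  by rewrite gE mulrDl -!mulrA -thE' quat_conj_mul Ndl -scalerAr mulr1.
exists u => //; split=> //; exists (quat_conj u); first exact: order_conj.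
(* [gamma] and [delta] have the same nonzero norm, so the conjugate of [u] is its inverse. *)
have Nu : quat_norm u = 1.
  apply: (mulIf M0); rewrite mul1r -[X in _ * X]Ndl -quat_normM -guE; exact: Ng.
by rewrite quat_mul_conj quat_conj_mul Nu scale1r.
Qed.

(** * Exchange of left and right by conjugation *)

Lemma right_pid_left_pid : right_pid H -> left_pid H.
Proof.
move=> pidH I [IH [I0 IB] IM].
have [|g gH gI] := pidH [pred x | quat_conj x \in I].
  split=> [x||h x hH].
  - by rewrite inE => /IH/order_conj; rewrite quat_conjK.
  - split=> [|x y]; rewrite !inE; last by rewrite quat_conjB; apply: IB.
    by rewrite -[0](subrr 1) quat_conjB subrr.
  - by rewrite !inE quat_conjM => xI; rewrite IM ?order_conj.
exists (quat_conj g) => [|x]; first exact: order_conj.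
have := gI (quat_conj x); rewrite inE quat_conjK => ->.
split=> -[h hH xE]; exists (quat_conj h); try exact: order_conj.
  by rewrite -quat_conjM -xE quat_conjK.
by rewrite xE quat_conjM quat_conjK.
Qed.

Lemma primitive_conj x : primitive H x -> primitive H (quat_conj x).
Proof.
case=> xH prim; split=> [|n n0]; first exact: order_conj.
by rewrite -quat_conjZ => /order_conj; rewrite quat_conjK; apply: prim.
Qed.

End Order.

Theorem theorem2p2 (a b : rat) (a_gt0 : 0 < a) (b_gt0 : 0 < b)
    (divA : division_ring (quat a b))
    (H : {pred quat a b}) (orderH : is_order H)
    (theta : quat a b) (primH : primitive H theta)
    (m : nat) (m_dvd : exists q : int, quat_norm theta = m%:R * q%:~R) :
  (left_pid H ->
   exists gamma : quat a b,
     [/\ gamma \in H, quat_norm gamma = m%:R, right_divisor H gamma theta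
       & forall delta : quat a b, delta \in H -> quat_norm delta = m%:R ->
           right_divisor H delta theta -> left_associate H gamma delta]) /\
  (right_pid H ->
   exists gamma : quat a b,
     [/\ gamma \in H, quat_norm gamma = m%:R, left_divisor H gamma theta
       & forall delta : quat a b, delta \in H -> quat_norm delta = m%:R ->
           left_divisor H delta theta -> right_associate H gamma delta]).
Proof.
split=> pidH; first exact: left_pid_right_divisor.
have conjH := order_conj orderH.
(* The conjugate of a right divisor of the conjugate of [theta] is a left divisor of [theta], of the
   same norm. *)
have [||gamma [gH Ng [f fH thE] gU]] := left_pid_right_divisor a_gt0 b_gt0
    orderH (theta := quat_conj theta) (m := m) (right_pid_left_pid orderH pidH).
- exact: primitive_conj.
- by rewrite quat_norm_conj.
exists (quat_conj gamma); rewrite quat_norm_conj conjH //; split=> //.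
  exists (quat_conj f); first exact: conjH.
  by rewrite -quat_conjM -thE quat_conjK.
move=> delta dH Nd [e eH thE'].
have [|||u [uH [v vH [uv vu]]] gE] := gU (quat_conj delta).
- exact: conjH.
- by rewrite quat_norm_conj.
- by exists (quat_conj e); [apply: conjH | rewrite -quat_conjM -thE'].
exists (quat_conj u); last by rewrite gE quat_conjM quat_conjK.
split; first exact: conjH.
exists (quat_conj v); first exact: conjH.
by rewrite -!quat_conjM uv vu quat_conj1.
Qed.
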